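(* For represented typed SCI problems $\mathbf S=(\Psi,\Omega_S,Y_S,\Lambda_S)$, $\mathbf P=(\Xi,\Omega_P,Y_P,\Lambda_P)$, the implication $$\mathbf S\le_{\mathrm{TTE},\mathrm{fq}}\mathbf P\ \Longrightarrow\ \widehat\Psi\le_{\mathrm{sW}}\widehat\Xi$$ is strict (it holds, and its converse fails in general). In fact, there are represented typed SCI problems $\mathbf S$ and $\mathbf P$ such that $\widehat\Psi\equiv_{\mathrm{sW}}\widehat\Xi$, but $\mathbf S\not\le_{\mathrm{raw},\mathrm{fq}}\mathbf P$, and hence also $\mathbf S\not\le_{\mathrm{TTE},\mathrm{fq}}\mathbf P$.
   Context: $\mathbb N_0=\{0,1,2,\dots\}$. Typed SCI computational problem: a tuple $\mathbf P=(\Xi,\Omega_P,Y_P,\Lambda_P)$ with $\Omega_P$ a set of instances, $Y_P$ a metric space, $\Xi:\Omega_P\to Y_P$ the target map, and $\Lambda_P$ a family of evaluations $\lambda:\Omega_P\to V_\lambda$, each with a specified value space $V_\lambda$. It is represented if $\Omega_P$, $Y_P$ and all $V_\lambda$ are represented spaces and the evaluation family is effectively indexed by a set of codes $I_P\subseteq\mathbb N$. $\widehat\Psi:\Omega_S\to Y_S$, $\widehat\Xi:\Omega_P\to Y_P$ denote $\Psi,\Xi$ viewed as maps between represented spaces. $\widehat\Psi\le_{\mathrm{sW}}\widehat\Xi$ means there are computable partial maps $H,K$ on Baire space such that $K\circ G\circ H$ realizes $\widehat\Psi$ for every realizer $G$ of $\widehat\Xi$; $\equiv_{\mathrm{sW}}$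 is mutual reducibility. Raw finite-query transport: $\mathbf S\le_{\mathrm{raw},\mathrm{fq}}\mathbf P$ if there are an arbitrary map $E:\Omega_S\to\Omega_P$, a continuous $D:Y_P\to Y_S$ with $D(\Xi(E(x)))=\Psi(x)$ for all $x$, and for every $\lambda\in\Lambda_P$ finitely many ($m_\lambda\in\mathbb N_0$) evaluations $\gamma_{\lambda,1},\dots,\gamma_{\lambda,m_\lambda}\in\Lambda_S$ and an arbitrary map $\vartheta_\lambda$ from their joint image (a point if $m_\lambda=0$) to $V_\lambda$ with $\lambda(E(x))=\vartheta_\lambda(\gamma_{\lambda,1}(x),\dots,\gamma_{\lambda,m_\lambda}(x))$ for all $x\in\Omega_S$. TTE finite-query transport: $\mathbf S\le_{\mathrm{TTE},\mathrm{fq}}\mathbf P$ if there are $E:\Omega_S\to\Omega_P$ and $D:Y_P\to Y_S$ with computable realizers, with $D(\Xi(E(x)))=\Psi(x)$ for all $x$, and such that, uniformly in a code of each $\lambda\in\Lambda_P$, one can compute $m_\lambda\in\mathbb N_0$, (codes of) $\gamma_{\lambda,1},\dots,\gamma_{\lambda,m_\lambda}\in\Lambda_S$ and an index of a computable partial map $\widehat\vartheta_\lambda$ from the product of their value spaces to $V_\lambda$ whose domain contains their joint image, with $\lambda(E(x))=\widehat\vartheta_\lambda(\gamma_{\lambda,1}(x),\dots,\gamma_{\lambda,m_\lambda}(x))$ for all $x\in\Omega_S$. Computable maps between the represented metric output spaces are understood to be continuous, so a TTE transport is in particular a raw transport. *)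

(* Defs.v *)
From Stdlib Require Import Reals Arith Cantor List FunctionalExtensionality.
Import ListNotations.
Open Scope nat_scope.
Set Implicit Arguments.
Unset Strict Implicit.

(** Stdlib world.  Partial maps [A -> B] are encoded as [A -> option B]
    throughout; under the classical axioms of Stdlib this covers every
    partial map. *)

Definition baire : Type := nat -> nat.

(** ** Oracle computability *)

(** Partial recursive functions of one natural number relative to an oracle;
    several arguments are packed with the Cantor pairing. *)
Inductive prog : Type :=
| Zero | Succ | Fst | Snd | Query
| Pair (a b : prog)
| Comp (a b : prog)
| Prec (a b : prog)
| Mu (a : prog).

(** [run p c x y]: program [c] with oracle [p] halts on [x] with value [y].
    - [Prec a b] maps [<z,0>] to [a z] and [<z,k+1>] to [b <z,<k,r>>], with [r]
      its own value at [<z,k>]; [s] below is the sequence of these values.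
    - [Mu a] maps [x] to the least [y] with [a <x,y> = 0], all the values
      [a <x,j>], [j < y], being defined. *)
Fixpoint run (p : baire) (c : prog) (x y : nat) {struct c} : Prop :=
  match c with
  | Zero => y = 0
  | Succ => y = S x
  | Fst => y = fst (of_nat x)
  | Snd => y = snd (of_nat x)
  | Query => y = p x
  | Pair a b => exists u v, run p a x u /\ run p b x v /\ y = to_nat (u, v)
  | Comp a b => exists u, run p b x u /\ run p a u y
  | Prec a b =>
      let (z, k) := of_nat x in
      exists s : nat -> nat,
        run p a z (s 0)
        /\ (forall j, j < k -> run p b (to_nat (z, to_nat (j, s j))) (s (S j)))
        /\ y = s k
  | Mu a =>
      run p a (to_nat (x, y)) 0
      /\ forall j, j < y -> exists v, run p a (to_nat (x, j)) (S v)
  end.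

(** Gödel numbers of programs. *)
Fixpoint prog_code (c : prog) : nat :=
  match c with
  | Zero => to_nat (0, 0)
  | Succ => to_nat (1, 0)
  | Fst => to_nat (2, 0)
  | Snd => to_nat (3, 0)
  | Query => to_nat (4, 0)
  | Pair a b => to_nat (5, to_nat (prog_code a, prog_code b))
  | Comp a b => to_nat (6, to_nat (prog_code a, prog_code b))
  | Prec a b => to_nat (7, to_nat (prog_code a, prog_code b))
  | Mu a => to_nat (8, prog_code a)
  end.

Fixpoint list_code (l : list nat) : nat :=
  match l with
  | [] => 0
  | n :: l' => S (to_nat (n, list_code l'))
  end.

(** Computation of a number from a number, without a (nontrivial) oracle. *)
Definition run_nat (c : prog) (x y : nat) : Prop := run (fun _ => 0) c x y.

(** Program [c] transforms the sequence [p] into the sequence [q]. *)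
Definition transforms (c : prog) (p q : baire) : Prop :=
  forall n, run p c n (q n).

Definition computable_by (c : prog) (F : baire -> option baire) : Prop :=
  forall p q, F p = Some q -> transforms c p q.

Definition computable (F : baire -> option baire) : Prop :=
  exists c, computable_by c F.

(** ** Represented spaces *)

Definition pcomp (A B C : Type) (g : B -> option C) (f : A -> option B)
  : A -> option C :=
  fun a => match f a with Some b => g b | None => None end.

Record representation (X : Type) : Type := {
  name_of :> baire -> option X;
  name_surj : forall x, exists p, name_of p = Some x
}.

(** [F] realizes the partial map [f]. *)
Definition realizes_partial (X Y : Type) (dX : representation X)
    (dY : representation Y) (F : baire -> option baire) (f : X -> option Y)
  : Prop :=
  forall p x y, dX p = Some x -> f x = Some y ->
    exists q, F p = Some q /\ dY q = Some y.

Definition realizes (X Y : Type) (dX : representation X)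
    (dY : representation Y) (F : baire -> option baire) (f : X -> Y) : Prop :=
  realizes_partial dX dY F (fun x => Some (f x)).

Definition computable_map (X Y : Type) (dX : representation X)
    (dY : representation Y) (f : X -> Y) : Prop :=
  exists F, computable F /\ realizes dX dY F f.

(** [c] computes a realizer of the partial map [f]. *)
Definition computes_partial (c : prog) (X Y : Type) (dX : representation X)
    (dY : representation Y) (f : X -> option Y) : Prop :=
  exists F, computable_by c F /\ realizes_partial dX dY F f.

(** Products of represented spaces: the sequence [<q,r>] with [q] on the even
    and [r] on the odd positions names [(x,y)] when [q] names [x] and [r]
    names [y]; every sequence names the point of [unit]. *)
Definition left_half (p : baire) : baire := fun n => p (2 * n).
Definition right_half (p : baire) : baire := fun n => p (2 * n + 1).

Definition unit_rep : representation unit.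
Proof.
  exists (fun _ => Some tt).
  intros []; exists (fun _ => 0); reflexivity.
Defined.

Definition pair_name (X Y : Type) (dX : representation X)
    (dY : representation Y) (p : baire) : option (X * Y) :=
  match dX (left_half p), dY (right_half p) with
  | Some x, Some y => Some (x, y)
  | _, _ => None
  end.

Lemma pair_name_surj (X Y : Type) (dX : representation X)
    (dY : representation Y) (xy : X * Y) :
  exists p, pair_name dX dY p = Some xy.
Proof.
  destruct xy as [x y].
  destruct (name_surj dX x) as [q Hq], (name_surj dY y) as [r Hr].
  exists (fun n => if Nat.even n then q (Nat.div2 n) else r (Nat.div2 n)).
  unfold pair_name.
  replace (left_half _) with q; [replace (right_half _) with r|].
  - now rewrite Hq, Hr.
  - apply functional_extensionality; intros n; unfold right_half.
    now rewrite Nat.add_1_r, Nat.even_succ, Nat.odd_even, Nat.div2_succ_double.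
  - apply functional_extensionality; intros n; unfold left_half.
    now rewrite Nat.even_even, Nat.div2_double.
Qed.

Definition pair_rep (X Y : Type) (dX : representation X)
    (dY : representation Y) : representation (X * Y) :=
  {| name_of := pair_name dX dY; name_surj := pair_name_surj dX dY |}.

(** ** Strong Weihrauch reducibility of maps between represented spaces *)

Definition sW_le (X Y Z W : Type)
    (dX : representation X) (dY : representation Y) (f : X -> Y)
    (dZ : representation Z) (dW : representation W) (g : Z -> W) : Prop :=
  exists H K : baire -> option baire,
    computable H /\ computable K /\
    forall G : baire -> option baire,
      realizes dZ dW G g -> realizes dX dY (pcomp K (pcomp G H)) f.

(** ** Typed SCI problems *)

Record sci_problem : Type := {
  inst : Type;
  out : Metric_Space;
  target : inst -> Base out;
  idx : Type;
  val : idx -> Type;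
  ev : forall i : idx, inst -> val i
}.

(** Product of the value spaces of a finite list of evaluations, and the
    corresponding joint evaluation. *)
Fixpoint vals (P : sci_problem) (l : list (idx P)) : Type :=
  match l with
  | [] => unit
  | i :: l' => (val i * vals l')%type
  end.

Fixpoint joint (P : sci_problem) (l : list (idx P)) (x : inst P) : vals l :=
  match l return vals l with
  | [] => tt
  | i :: l' => (ev i x, joint l' x)
  end.

Definition joint_image (P : sci_problem) (l : list (idx P)) : Type :=
  { v : vals l | exists x, joint l x = v }.

Definition to_joint_image (P : sci_problem) (l : list (idx P)) (x : inst P)
  : joint_image l :=
  exist _ (joint l x) (ex_intro _ x eq_refl).

(** The evaluations are numbered by the partial surjection [numbering]; its
    domain is the set of codes. *)
Record rep_sci_problem : Type := {
  problem :> sci_problem;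
  inst_rep : representation (inst problem);
  out_rep : representation (Base (out problem));
  val_rep : forall i : idx problem, representation (val i);
  numbering : nat -> option (idx problem);
  numbering_surj : forall i, exists n, numbering n = Some i
}.

(** From a code of an evaluation and a name of an instance one can compute a
    name of the value, uniformly. *)
Definition effective_evaluations (P : rep_sci_problem) : Prop :=
  exists c : prog,
    forall n i, numbering P n = Some i ->
    forall p x, inst_rep P p = Some x ->
    exists q, (forall k, run p c (to_nat (n, k)) (q k))
              /\ val_rep i q = Some (ev i x).

Fixpoint vals_rep (P : rep_sci_problem) (l : list (idx P))
  : representation (vals l) :=
  match l return representation (vals l) with
  | [] => unit_rep
  | i :: l' => pair_rep (val_rep i) (vals_rep l')
  end.

Definition continuous_map (X Y : Metric_Space) (f : Base X -> Base Y) : Prop :=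
  forall x, limit_in X Y f (fun _ => True) x (f x).

(** ** Finite-query transports *)

Definition raw_fq_le (S P : sci_problem) : Prop :=
  exists (E : inst S -> inst P) (D : Base (out P) -> Base (out S)),
    continuous_map D
    /\ (forall x, D (target (E x)) = target x)
    /\ forall i : idx P,
         exists (l : list (idx S)) (theta : joint_image l -> val i),
           forall x, ev i (E x) = theta (to_joint_image l x).

(** A computable map between represented metric spaces is, by convention, also
    continuous for the metrics; hence both requirements on [D]. *)
Definition tte_fq_le (S P : rep_sci_problem) : Prop :=
  exists (E : inst S -> inst P) (D : Base (out P) -> Base (out S)),
    computable_map (inst_rep S) (inst_rep P) E
    /\ computable_map (out_rep P) (out_rep S) D
    /\ continuous_map D
    /\ (forall x, D (target (E x)) = target x)
    /\ exists t : prog,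
         forall n i, numbering P n = Some i ->
         exists (codes : list nat) (l : list (idx S)) (c : prog)
                (theta : vals l -> option (val i)),
           run_nat t n (to_nat (list_code codes, prog_code c))
           /\ Forall2 (fun j g => numbering S j = Some g) codes l
           /\ computes_partial c (vals_rep l) (val_rep i) theta
           /\ forall x, theta (joint l x) = Some (ev i (E x)).

(** Strong Weihrauch reducibility of the target maps. *)
Definition target_sW_le (S P : rep_sci_problem) : Prop :=
  sW_le (inst_rep S) (out_rep S) (@target S)
        (inst_rep P) (out_rep P) (@target P).

Definition target_sW_equiv (S P : rep_sci_problem) : Prop :=
  target_sW_le S P /\ target_sW_le P S.

(* Main.v *)
Require Import Defs.
From Stdlib Require Import Reals Arith Lia List Classical ClassicalEpsilon.
Open Scope nat_scope.

(** A transport consists of a computable preprocessing [E] and a computable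
    postprocessing [D]; their realizers are themselves a strong Weihrauch
    reduction between the targets ([tte_fq_le_sW_le]).

    For the failure of the converse, the same target map is given two different
    families of evaluations.  The strong Weihrauch degree sees only the target,
    so the two problems are equivalent.  The target is the identity of [nat];
    one problem ([point_queries]) offers the tests [x = k] for all [k], the
    other ([full_query]) offers [x] itself.  Each natural number is determined
    by the tests, and by a single positive one, but finitely many tests cannot
    tell apart two numbers that are larger than all the tested ones.  If
    [point_queries] were transported to [full_query] by [E] and [D], then
    [E x] would be a function of finitely many tests, hence so would
    [x = D (E x)], which is absurd ([point_queries_not_raw_le_full_query]).
    Since every computable transport is a raw one ([tte_fq_le_raw]), this also
    excludes computable transports. *)

(** The realizers of [E] and [D] serve as the outer maps of the reduction: a
    realizer of the target of [P] turns a name of [E x] into a name of the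
    target at [E x], which [D] sends to the target of [S] at [x]. *)
Lemma tte_fq_le_sW_le (S P : rep_sci_problem) :
  tte_fq_le S P -> target_sW_le S P.
Proof.
  intros (E & D & (H & cH & rH) & (K & cK & rK) & _ & DE & _).
  exists H, K; split; [exact cH | split; [exact cK |]].
  intros G rG p x y Hp Hy.
  injection Hy as <-.
  destruct (rH p x _ Hp eq_refl) as (q & Hq & nq).
  destruct (rG q _ _ nq eq_refl) as (r & Hr & nr).
  destruct (rK r _ _ nr eq_refl) as (s & Hs & ns).
  exists s; split.
  - unfold pcomp; now rewrite Hq, Hr.
  - now rewrite ns, DE.
Qed.

(** The partial map that recovers an evaluation of [P] is defined on the whole
    joint image, so that it restricts to a total map there. *)
Lemma tte_fq_le_raw (S P : rep_sci_problem) : tte_fq_le S P -> raw_fq_le S P.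
Proof.
  intros (E & D & _ & _ & cD & DE & t & Ht).
  exists E, D; split; [exact cD | split; [exact DE |]].
  intros i.
  destruct (numbering_surj i) as [n Hn].
  destruct (Ht n i Hn) as (codes & l & c & theta & _ & _ & _ & Htheta).
  assert (total : forall v : joint_image l,
             {y | theta (proj1_sig v) = Some y}).
  { intros [v Hv]; cbn.
    destruct (theta v) as [y|] eqn:e; [now exists y | exfalso].
    destruct Hv as [x <-].
    now rewrite Htheta in e. }
  exists l, (fun v => proj1_sig (total v)).
  intros x.
  destruct (total (to_joint_image l x)) as [y Hy]; cbn in *.
  rewrite Htheta in Hy; now injection Hy.
Qed.

Lemma sW_le_refl (X Y : Type) (dX : representation X) (dY : representation Y)
    (f : X -> Y) : sW_le dX dY f dX dY f.
Proof.
  assert (cid : computable (fun p => Some p)).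
  { exists Query; intros p q e n; injection e as <-; reflexivity. }
  exists (fun p => Some p), (fun p => Some p).
  split; [exact cid | split; [exact cid |]].
  intros G rG p x y Hp Hy.
  destruct (rG p x y Hp Hy) as (q & Hq & nq).
  exists q; split; [unfold pcomp; now rewrite Hq | exact nq].
Qed.

(** Being a name is undecidable in general, hence the appeal to excluded
    middle. *)
Definition decode {X : Type} (enc : X -> baire) (p : baire) : option X :=
  match excluded_middle_informative (exists x, enc x = p) with
  | left h => Some (proj1_sig (constructive_indefinite_description _ h))
  | right _ => None
  end.

Lemma decode_sound {X : Type} (enc : X -> baire) p x :
  decode enc p = Some x -> enc x = p.
Proof.
  unfold decode.
  destruct (excluded_middle_informative _) as [h|]; [|discriminate].
  intros e; injection e as <-.
  exact (proj2_sig (constructive_indefinite_description _ h)).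
Qed.

Lemma decode_encode {X : Type} (enc : X -> baire)
    (enc_inj : forall x y, enc x = enc y -> x = y) x :
  decode enc (enc x) = Some x.
Proof.
  destruct (decode enc (enc x)) as [y|] eqn:e.
  - f_equal; now apply enc_inj, decode_sound.
  - unfold decode in e.
    destruct (excluded_middle_informative _) as [|h]; [discriminate|].
    destruct h; now exists x.
Qed.

Definition encoding_rep {X : Type} (enc : X -> baire)
    (enc_inj : forall x y, enc x = enc y -> x = y) : representation X :=
  {| name_of := decode enc;
     name_surj := fun x => ex_intro _ (enc x) (decode_encode enc enc_inj x) |}.

Definition bit (b : bool) : nat := if b then 1 else 0.

(** With indicator sequences as names, the test [x = k] is read off a name of
    [x] by a single oracle query. *)
Definition indicator (n : nat) : baire := fun k => bit (n =? k).

Lemma indicator_inj m n : indicator m = indicator n -> m = n.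
Proof.
  intros e.
  assert (en : indicator m n = indicator n n) by now rewrite e.
  unfold indicator in en; rewrite Nat.eqb_refl in en.
  destruct (Nat.eqb_spec m n); [assumption | discriminate].
Qed.

Definition bool_name (b : bool) : baire := fun _ => bit b.

Lemma bool_name_inj b c : bool_name b = bool_name c -> b = c.
Proof.
  intros e.
  assert (e0 : bool_name b 0 = bool_name c 0) by now rewrite e.
  destruct b, c; easy.
Qed.

Definition nat_rep : representation nat := encoding_rep indicator indicator_inj.
Definition bool_rep : representation bool :=
  encoding_rep bool_name bool_name_inj.

Definition nat_dist (m n : nat) : R := Rdist (INR m) (INR n).

Lemma nat_dist_refl m n : nat_dist m n = 0%R <-> m = n.
Proof.
  unfold nat_dist; rewrite Rdist_refl.
  split; [apply INR_eq | now intros ->].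
Qed.

Definition nat_metric : Metric_Space :=
  {| Base := nat;
     dist := nat_dist;
     dist_pos := fun m n => Rdist_pos (INR m) (INR n);
     dist_sym := fun m n => Rdist_sym (INR m) (INR n);
     dist_refl := nat_dist_refl;
     dist_tri := fun m n k => Rdist_tri (INR m) (INR n) (INR k) |}.

Definition point_queries : rep_sci_problem :=
  {| problem :=
       {| inst := nat; out := nat_metric; target := fun x => x;
          idx := nat; val := fun _ => bool; ev := fun k x => x =? k |};
     inst_rep := nat_rep;
     out_rep := nat_rep;
     val_rep := fun _ => bool_rep;
     numbering := fun n => Some n;
     numbering_surj := fun k => ex_intro _ k eq_refl |}.

Definition full_query : rep_sci_problem :=
  {| problem :=
       {| inst := nat; out := nat_metric; target := fun x => x;
          idx := unit; val := fun _ => nat; ev := fun _ x => x |};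
     inst_rep := nat_rep;
     out_rep := nat_rep;
     val_rep := fun _ => nat_rep;
     numbering := fun _ => Some tt;
     numbering_surj := fun u =>
       match u with tt => ex_intro _ 0 eq_refl end |}.

(** The name [p] of [x] has the outcome of the test [x = n] at position [n];
    the name of this outcome repeats it at every position. *)
Lemma point_queries_effective : effective_evaluations point_queries.
Proof.
  exists (Comp Query Fst).
  intros n i e p x Hp; injection e as <-; cbn in Hp, x.
  apply decode_sound in Hp; subst p.
  exists (bool_name (x =? n)); split.
  - intros k; exists n; cbn [run]; now rewrite Cantor.cancel_of_to.
  - exact (decode_encode bool_name bool_name_inj _).
Qed.

(** The value is named by the given name of the instance. *)
Lemma full_query_effective : effective_evaluations full_query.
Proof.
  exists (Comp Query Snd).
  intros n i _ p x Hp.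
  exists p; split; [|exact Hp].
  intros k; exists k; cbn [run]; now rewrite Cantor.cancel_of_to.
Qed.

(** All the tests come out negative on an untested number. *)
Lemma joint_point_queries_untested (l : list nat) x y :
  ~ In x l -> ~ In y l ->
  joint (P := point_queries) l x = joint (P := point_queries) l y.
Proof.
  induction l as [|k l IH]; intros Hx Hy; [reflexivity|].
  cbn in Hx, Hy.
  apply (f_equal2 pair); [|apply IH; tauto]; cbn.
  destruct (Nat.eqb_spec x k), (Nat.eqb_spec y k);
    reflexivity || (exfalso; auto).
Qed.

Lemma point_queries_not_raw_le_full_query :
  ~ raw_fq_le point_queries full_query.
Proof.
  intros (E & D & _ & DE & Hev).
  destruct (Hev tt) as (l & theta & Htheta).
  assert (untested : forall x, list_max l < x -> ~ In x l).
  { intros x Hx Hin.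
    enough (x <= list_max l) by lia.
    assert (Hall : Forall (fun k => k <= list_max l) l)
      by now apply list_max_le.
    now apply (proj1 (Forall_forall _ _) Hall). }
  set (x := S (list_max l)).
  set (y := S x).
  assert (same : to_joint_image (P := point_queries) l x
                 = to_joint_image (P := point_queries) l y).
  { apply eq_sig_hprop; [intros; apply proof_irrelevance|].
    apply joint_point_queries_untested; apply untested; subst x y; lia. }
  assert (xy : x = y).
  { assert (Exy : E x = E y).
    { etransitivity; [apply Htheta|].
      etransitivity; [apply (f_equal theta same) | symmetry; apply Htheta]. }
    etransitivity; [symmetry; apply DE|].
    etransitivity; [|apply DE].
    exact (f_equal D Exy). }
  subst y; lia.
Qed.

Theorem corollary5p1 :
  (forall S P : rep_sci_problem, tte_fq_le S P -> target_sW_le S P)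
  /\ ~ (forall S P : rep_sci_problem,
          effective_evaluations S -> effective_evaluations P ->
          target_sW_le S P -> tte_fq_le S P)
  /\ (exists S P : rep_sci_problem,
        effective_evaluations S /\ effective_evaluations P
        /\ target_sW_equiv S P
        /\ ~ raw_fq_le S P
        /\ ~ tte_fq_le S P).
Proof.
  assert (not_tte : ~ tte_fq_le point_queries full_query).
  { intros Htte.
    now apply point_queries_not_raw_le_full_query, tte_fq_le_raw. }
  split; [exact tte_fq_le_sW_le | split].
  - intros converse; apply not_tte, converse.
    + exact point_queries_effective.
    + exact full_query_effective.
    + apply sW_le_refl.
  - exists point_queries, full_query.
    split; [exact point_queries_effective|].
    split; [exact full_query_effective|].
    split; [split; apply sW_le_refl|].
    split; [exact point_queries_not_raw_le_full_query | exact not_tte].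
Qed.
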